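(* Let $0<r_{\min}<r_{\max}<\infty$, let $\mathcal{F}(dr)=\mathcal{F}(r)\,dr$ be a finite measure on $(0,\infty)$ whose density $\mathcal{F}(r)$ is strictly positive on $[r_{\min},r_{\max}]$ and equal to zero otherwise, and let $(z_t(r),r_t)$ be a family of trajectories and radii satisfying the assumptions listed in the context, with duration $\zeta(r)$, mean function $m$ and top quantile $z_{100}$. Suppose that $r\mapsto\zeta(r)$ is (finite and) continuous on $[r_{\min},r_{\max}]$, that $(t,r)\mapsto(r_t,z_t(r))$ is continuous on $$A=\{(t,r)\mid 0\le t\le\zeta(r),\ r_{\min}\le r\le r_{\max}\},$$ and that $m$ is a continuous function of $z$. Then $$z_{100}=\max_{(t,r)\in A}z_t(r).$$
   Context: Trajectories and radii: for each $r>0$, $t\mapsto z_t(r)$ and $t\mapsto r_t$ (the latter also depends on the initial radius $r$, suppressed in the notation) are nonnegative functions of $t\ge0$ with $r_0=r$, $z_0(r)=0$. The duration is $\zeta=\zeta(r)=\inf\{t>0\mid z_t(r)=0\text{ or }r_t=0\}$. Assumptions: (i) $r_t$ and $z_t(r)$ are continuous in $t$ on $[0,\zeta]$; (ii) if $r_t=0$ for some $t>0$ then $r_s=0$ and $z_s(r)=0$ for all $s\ge t$; (iii) if $z_t(r)=0$ for some $t>0$ then $z_s(r)=0$ and $r_s=0$ for all $s\ge t$. Mean function: for a constant $\rho>0$ and $z\ge0$, $$m(z)=\tfrac{4}{3}\pi\rho\int_0^\infty\int_0^\infty r_s^3\,1_{(0,z]}(z_s(r))\,\mathcal{F}(r)\,dr\,ds,$$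 where $1_{(0,z]}$ is the indicator function of $(0,z]$ (so $m(0)=0$). Top quantile: $z_{100}\ge0$ is the height such that $m(z)=m(z_{100})$ for all $z\ge z_{100}$ and $m(z)<m(z_{100})$ for every $0\le z<z_{100}$; equivalently $z_{100}$ is the least height beyond which $m$ is constant. *)

(* Defs.v *)
From HB Require Import structures.
From mathcomp Require Import all_boot all_order all_algebra.
From mathcomp Require Import all_classical all_reals all_analysis.
Set Implicit Arguments.
Unset Strict Implicit.
Unset Printing Implicit Defensive.
Import Order.TTheory GRing.Theory Num.Theory.
Import numFieldNormedType.Exports.
Local Open Scope classical_set_scope.
Local Open Scope ring_scope.

(* Throughout, [rad t r] is the radius r_t of the particle of initial radius r,
   and [traj t r] is its height z_t(r). Only the values at t >= 0 and r > 0
   matter. *)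

(* The infimum is taken in \bar R, so that it is +oo when the particle never
   lands nor vanishes (the real-valued [inf] would be 0 there). *)
Definition duration (R : realType) (rad traj : R -> R -> R) (r : R) : \bar R :=
  ereal_inf (EFin @` [set t | 0 < t /\ (traj t r = 0 \/ rad t r = 0)]).

Record trajectory_family (R : realType) (rad traj : R -> R -> R) : Prop := {
  rad_ge0 : forall r t, 0 < r -> 0 <= t -> 0 <= rad t r ;
  traj_ge0 : forall r t, 0 < r -> 0 <= t -> 0 <= traj t r ;
  rad_init : forall r, 0 < r -> rad 0 r = r ;
  traj_init : forall r, 0 < r -> traj 0 r = 0 ;
  rad_continuous : forall r, 0 < r ->
    {within [set t | 0 <= t /\ (t%:E <= duration rad traj r)%E],
      continuous (fun t => rad t r)} ;
  traj_continuous : forall r, 0 < r ->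
    {within [set t | 0 <= t /\ (t%:E <= duration rad traj r)%E],
      continuous (fun t => traj t r)} ;
  rad_absorbed : forall r t, 0 < r -> 0 < t -> rad t r = 0 ->
    forall s, t <= s -> rad s r = 0 /\ traj s r = 0 ;
  traj_absorbed : forall r t, 0 < r -> 0 < t -> traj t r = 0 ->
    forall s, t <= s -> traj s r = 0 /\ rad s r = 0
}.

(* Valued in \bar R, so that finiteness of the integral is not presupposed. *)
Definition mean_function (R : realType) (rho : R) (F : R -> R)
    (rad traj : R -> R -> R) (z : R) : \bar R :=
  ((4 / 3 * pi * rho)%:E *
   \int[@lebesgue_measure R]_(s in `]0%R, +oo[)
     \int[@lebesgue_measure R]_(r in `]0%R, +oo[)
       (rad s r ^+ 3 * \1_`]0, z] (traj s r) * F r)%:E)%E.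

Definition is_top_quantile (R : realType) (m : R -> \bar R) (q : R) : Prop :=
  [/\ 0 <= q,
      forall z, q <= z -> m z = m q
    & forall z, 0 <= z -> z < q -> (m z < m q)%E].

(* Points are pairs (t, r): time first, initial radius second. *)
Definition lifetime_region (R : realType) (rmin rmax : R)
    (rad traj : R -> R -> R) : set (R * R) :=
  [set p | [/\ 0 <= p.1, (p.1%:E <= duration rad traj p.2)%E,
               rmin <= p.2 & p.2 <= rmax]].

Definition is_maximum (R : realType) (S : set R) (M : R) : Prop :=
  S M /\ ubound S M.

(* Main.v *)
(** By Tonelli, [mean_function] at [z] is a positive multiple of the integral over
    the product Lebesgue measure of [rad ^ 3 * F] on the part of the lifetime
    region A where [0 < traj <= z]. This is constant in [z] beyond [max_A traj].
    For [z < max_A traj], continuity of [traj] and of the duration gives an open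
    rectangle inside A, slightly earlier than a point of maximum, on which
    [traj > z]; there [rad] and [F] are positive, so the integral increases
    strictly. The strict inequality needs the integral to be finite, which follows
    from the compactness of A and the integrability of [F]. *)
Require Import Defs.
From HB Require Import structures.
From mathcomp Require Import all_boot all_order all_algebra.
From mathcomp Require Import all_classical all_reals all_analysis.
From mathcomp Require Import measurable_realfun lra.
Set Implicit Arguments.
Unset Strict Implicit.
Unset Printing Implicit Defensive.
Import Order.TTheory GRing.Theory Num.Theory.
Import numFieldNormedType.Exports.
Local Open Scope classical_set_scope.
Local Open Scope ring_scope.

(** * Measurability in the plane and strict comparison of integrals *)

Lemma open_measurable_prod (R : realType) (U : set (R * R)) :
  open U -> measurable U.
Proof.
move=> oU.
(* Squares with rational centres and radius 1/(n+1) are countably many, and [U] is the union of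
   those it contains. *)
pose box (i : rat * rat * nat) : set (R * R) :=
  ball (ratr i.1.1 : R) i.2.+1%:R^-1 `*` ball (ratr i.1.2 : R) i.2.+1%:R^-1.
pose I := [set i | box i `<=` U].
have -> : U = \bigcup_(i in I) box i.
  apply/seteqP; split => [[x y] Uxy|p [i Ii]]; last exact: Ii.
  have /nbhs_ballP[_/posnumP[e] eU] : nbhs (x, y) U by exact: open_nbhs_nbhs.
  (* Half of [e] suffices for the radius: two points of a common square are then within [e] of each
     other, by passing through its centre. *)
  have [n /= ne] : exists n, n.+1%:R^-1 < e%:num / 2 :> R.
    exists (Num.truncn (e%:num / 2)^-1).
    by rewrite invf_plt ?posrE// truncnS_gt.
  have n0 : 0 < n.+1%:R^-1 :> R by rewrite invr_gt0.
  have near_trans (q z w : R) :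
      ball q n.+1%:R^-1 z -> ball q n.+1%:R^-1 w -> ball z e%:num w.
    rewrite -!ball_normE/= (distrC q z) => qz qw.
    rewrite (le_lt_trans (ler_distD q _ _))//.
    by rewrite (lt_trans (ltrD qz qw))// [ltRHS]splitr ltrD.
  have near_rat (z : R) : exists q : rat, ball (ratr q : R) n.+1%:R^-1 z.
    have /rat_in_itvoo[q] : z < z + n.+1%:R^-1 by rewrite ltrDl.
    rewrite in_itv/= => /andP[zq qz]; exists q.
    by rewrite -ball_normE/= gtr0_norm ?subr_gt0 // ltrBlDl.
  have [q1 xq1] := near_rat x; have [q2 yq2] := near_rat y.
  exists (q1, q2, n); last by split.
  move=> [x' y'] [/= x'q y'q]; apply: eU; split => /=.
    exact: near_trans xq1 x'q.
  exact: near_trans yq2 y'q.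
rewrite bigcup_mkcond; apply: countable_bigcupT_measurable => // i.
case: ifPn => // _; apply: measurableX; apply: open_measurable; exact: ball_open.
Qed.

Lemma closed_measurable_prod (R : realType) (A : set (R * R)) :
  closed A -> measurable A.
Proof.
by move=> /closed_openC/open_measurable_prod/measurableC; rewrite setCK.
Qed.

Lemma within_continuous_measurable_prod (R : realType) (A : set (R * R))
    (f : R * R -> R) :
  closed A -> {within A, continuous f} -> measurable_fun A f.
Proof.
move=> cA /continuousP cf.
apply: (measurability _ (RGenOpens.measurableE R)).
move=> _ [_ [a [b ->] <-]].
(* The preimage of an open interval is the trace on [A] of an open set [V] of the plane. *)
have /open_subspaceP[V oV VA] : open (from_subspace A f @^-1` `]a, b[).
  exact/cf/interval_open.
rewrite setIC -VA; apply: measurableI; first exact: open_measurable_prod.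
exact: closed_measurable_prod.
Qed.

(** If the integral of the nonnegative difference g - f were zero, the difference would vanish
    almost everywhere, contradicting its positivity on [E]. Finiteness of the integral of [f] makes
    adding a positive quantity a strict increase. *)
Lemma lt_integral d (T : measurableType d) (R : realType)
    (mu : {measure set T -> \bar R}) (D E : set T) (f g : T -> \bar R) :
  measurable D -> measurable_fun D f -> measurable_fun D g ->
  (forall x, D x -> 0 <= f x)%E -> (forall x, D x -> f x \is a fin_num) ->
  (forall x, D x -> f x <= g x)%E ->
  (\int[mu]_(x in D) f x < +oo)%E ->
  measurable E -> E `<=` D -> (0 < mu E)%E -> (forall x, E x -> f x < g x)%E ->
  (\int[mu]_(x in D) f x < \int[mu]_(x in D) g x)%E.
Proof.
move=> mD mf mg f0 ffin fg foo mE ED E0 Efg.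
have mgf : measurable_fun D (fun x => g x - f x)%E by exact: emeasurable_funB.
have gf0 x : D x -> (0 <= g x - f x)%E.
  by move=> Dx; rewrite sube_ge0 ?fg// ffin.
have -> : (\int[mu]_(x in D) g x =
    \int[mu]_(x in D) f x + \int[mu]_(x in D) (g x - f x))%E.
  rewrite -ge0_integralD//; apply: eq_integral => x /set_mem Dx.
  by rewrite addeC subeK// ffin.
rewrite lteDl; last by rewrite ge0_fin_numE// integral_ge0.
rewrite lt0e integral_ge0// andbT; apply/eqP => gf_eq0.
have /(ae_eq_integral_abs mu mD mgf)[N [mN N0 DN]] :
    (\int[mu]_(x in D) `|g x - f x| = 0)%E.
  rewrite -[RHS]gf_eq0; apply: eq_integral => x /set_mem Dx.
  by rewrite gee0_abs// gf0.
suff : mu E = 0%E by apply/eqP; rewrite gt_eqF.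
apply: subset_measure0 N0 => // x Ex; apply: DN => /= /(_ (ED _ Ex)) /eqP.
by rewrite gt_eqF// sube_gt0 Efg.
Qed.

(* The region is the image of [0, 1] x [a, b] under (u, r) |-> (u D(r), r). *)
Lemma compact_subgraph (R : realType) (a b : R) (D : R -> R) :
  {within `[a, b], continuous D} -> (forall r, a <= r <= b -> 0 <= D r) ->
  compact [set p : R * R | [/\ 0 <= p.1, p.1 <= D p.2, a <= p.2 & p.2 <= b]].
Proof.
move=> cD D0.
pose h (p : R * R) : R * R := (p.1 * D p.2, p.2).
have -> : [set p : R * R | [/\ 0 <= p.1, p.1 <= D p.2, a <= p.2 & p.2 <= b]] =
    h @` (`[0, 1] `*` `[a, b]).
  apply/seteqP; split => [[t r]/= [t0 tD ar rb]|y [[u r]/= [+ +] <-]]; last first.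
    rewrite !in_itv/= => /andP[u0 u1] /[dup] rab /andP[ar rb].
    by split => //=; rewrite ?mulr_ge0 ?ler_piMl ?D0.
  have rab : a <= r <= b by rewrite ar rb.
  have [D_eq0|D_neq0] := eqVneq (D r) 0.
    exists (0, r); rewrite /= ?in_itv/= ?ar ?rb ?lexx ?ler01//.
    by rewrite /h/= mul0r; congr pair; apply/eqP; rewrite eq_le t0 -D_eq0 tD.
  have D_gt0 : 0 < D r by rewrite lt0r D_neq0 D0.
  exists (t / D r, r); rewrite /h/= ?in_itv/= ?ar ?rb ?divfK//.
  by rewrite divr_ge0 ?D0//= ler_pdivrMr// mul1r tD.
apply: continuous_compact; last first.
  by apply: compact_setX; exact: segment_compact.
apply/subspace_continuousP => -[u r] /= [_ rab].
have cDr : D x.2 @[x --> within (`[0, 1] `*` `[a, b]) (nbhs (u, r))] --> D r.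
  move=> P /((subspace_continuousP _ _).1 cD _ rab)/= rP.
  have : \forall p \near (u, r), `[a, b]%classic p.2 -> P (D p.2).
    exact: (@cvg_snd R R (nbhs u) (nbhs r) _ _ rP).
  by apply: filterS => p ? [].
have cpr (V : topologicalType) (g : R * R -> V) : {for (u, r), continuous g} ->
    g x @[x --> within (`[0, 1] `*` `[a, b]) (nbhs (u, r))] --> g (u, r).
  by move=> cg; apply: cvg_trans cg; apply: cvg_app; exact: cvg_within.
have c1 : x.1 @[x --> within (`[0, 1] `*` `[a, b]) (nbhs (u, r))] --> u.
  by apply: cpr; exact: cvg_fst.
have c2 : x.2 @[x --> within (`[0, 1] `*` `[a, b]) (nbhs (u, r))] --> r.
  by apply: cpr; exact: cvg_snd.
exact: cvg_pair (cvgM c1 cDr) c2.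
Qed.

(** * The duration and what happens after it *)

Lemma duration_ge0 (R : realType) (rad traj : R -> R -> R) (r : R) :
  (0 <= duration rad traj r)%E.
Proof. by apply: le_ereal_inf_tmp => _ [t [t0 _] <-]; rewrite lee_fin ltW. Qed.

(** An infimum below t provides an earlier time at which the height or the radius is zero; in either
    case absorption makes both zero from then on. *)
Lemma vanish_after_duration (R : realType) (rad traj : R -> R -> R) (r t : R) :
  trajectory_family rad traj -> 0 < r -> (duration rad traj r < t%:E)%E ->
  rad t r = 0 /\ traj t r = 0.
Proof.
move=> fam r0 /ereal_inf_lt[_ [s [s0 sr0] <-]]; rewrite lte_fin => /ltW st.
case: sr0 => sr0; last exact: (rad_absorbed fam r0 s0 sr0 st).
by have [] := traj_absorbed fam r0 s0 sr0 st.
Qed.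

(** * The integrand of the mean function as a density on the plane *)

Section mass_density.
Context (R : realType) (rmin rmax : R) (F : R -> R) (rad traj : R -> R -> R).
Let A := lifetime_region rmin rmax rad traj.

(** Extension by zero outside [A] gives a function on the whole plane, to which Tonelli applies, and
    discards the arbitrary values of [rad] and [traj] at negative times or radii. *)
Definition mass_density (z : R) : R * R -> R :=
  (fun p => rad p.1 p.2 ^+ 3 * \1_`]0, z] (traj p.1 p.2) * F p.2) \_ A.

Context (rmin_gt0 : 0 < rmin) (rmin_lt_rmax : rmin < rmax)
    (F_integrable :
      lebesgue_measure.-integrable (`]0, +oo[ : set R) (EFin \o F))
    (F_gt0 : forall r, rmin <= r <= rmax -> 0 < F r)
    (F_eq0 : forall r, 0 < r -> ~~ (rmin <= r <= rmax) -> F r = 0)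
    (family : trajectory_family rad traj)
    (duration_finite :
      forall r, rmin <= r <= rmax -> duration rad traj r \is a fin_num)
    (duration_continuous :
      {within `[rmin, rmax], continuous (fun r => fine (duration rad traj r))})
    (joint_continuous :
      {within A, continuous (fun p : R * R => (rad p.1 p.2, traj p.1 p.2))}).

Lemma mass_density_ge0 z p : 0 <= mass_density z p.
Proof.
rewrite /mass_density patchE; case: ifPn => // /set_mem[p0 _ ap pb].
have p2 : 0 < p.2 by exact: lt_le_trans ap.
apply: mulr_ge0; last by rewrite ltW// F_gt0// ap.
by rewrite mulr_ge0// exprn_ge0// (rad_ge0 family).
Qed.

(** Cutting down to [A] loses nothing: off [A], either the radius lies outside the support of [F],
    or the duration has passed and the height is 0, which the half-open interval excludes. *)
Lemma mass_densityE z p : 0 < p.2 -> 0 < p.1 ->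
  rad p.1 p.2 ^+ 3 * \1_`]0, z] (traj p.1 p.2) * F p.2 = mass_density z p.
Proof.
move=> p2 p1; rewrite /mass_density patchE; case: ifPn => // /negP pA.
have [p2ab|p2ab] := boolP (rmin <= p.2 <= rmax); last by rewrite F_eq0// mulr0.
have [|p1D] := leP p.1%:E (duration rad traj p.2).
  by move=> p1D; case: pA; apply/mem_set; case/andP: p2ab; split => //; exact: ltW.
have [_ ->] := vanish_after_duration family p2 p1D.
by rewrite indicE memNset ?mulr0 ?mul0r//= in_itv/= ltxx.
Qed.

(** Radii in [A] are positive, so the only points of [A] concerned have time 0, where the height is
    0. This permits integration over the plane instead of the open quadrant. *)
Lemma mass_density_eq0 z p : ~~ ((0 < p.2) && (0 < p.1)) ->
  mass_density z p = 0.
Proof.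
move=> p12; rewrite /mass_density patchE; case: ifPn => // /set_mem[p0 _ ap pb].
have p2 : 0 < p.2 by exact: lt_le_trans ap.
move: p12; rewrite p2/= -leNgt => p1; have -> : p.1 = 0 by apply/eqP; rewrite eq_le p1.
rewrite (traj_init family)//.
by rewrite indicE memNset ?mulr0 ?mul0r//= in_itv/= ltxx.
Qed.

(** * Compactness of the lifetime region and measurability of the density *)

Lemma lifetime_regionE : A = [set p | [/\ 0 <= p.1,
  p.1 <= fine (duration rad traj p.2), rmin <= p.2 & p.2 <= rmax]].
Proof.
apply/seteqP; split => -[t r]/= [/= t0 tD ar rb]; split => //=.
  by rewrite -lee_fin fineK// duration_finite// ar.
by rewrite -lee_fin fineK// duration_finite// ar in tD.
Qed.

Lemma lifetime_region_compact : compact A.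
Proof.
rewrite lifetime_regionE; apply: (compact_subgraph duration_continuous) => r rab.
exact/fine_ge0/duration_ge0.
Qed.

Lemma lifetime_region_closed : closed A.
Proof. exact: (compact_closed (@norm_hausdorff _ (R * R)%type) lifetime_region_compact). Qed.

Lemma lifetime_region_measurable : measurable A.
Proof.
exact: closed_measurable_prod lifetime_region_closed.
Qed.

Lemma rad_within_continuous :
  {within A, continuous (fun p : R * R => rad p.1 p.2)}.
Proof.
apply: (@within_continuous_comp _ _ _ _ _ (@fst R R) _ joint_continuous).
by move=> p _; exact: cvg_fst.
Qed.

Lemma traj_within_continuous :
  {within A, continuous (fun p : R * R => traj p.1 p.2)}.
Proof.
apply: (@within_continuous_comp _ _ _ _ _ (@snd R R) _ joint_continuous).
by move=> p _; exact: cvg_snd.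
Qed.

Lemma mass_density_measurable z :
  measurable_fun setT (EFin \o mass_density z).
Proof.
apply/measurable_EFinP/(measurable_restrictT _ lifetime_region_measurable).
have mwithin := within_continuous_measurable_prod lifetime_region_closed.
apply: measurable_funM; first apply: measurable_funM.
- have mrad := mwithin _ rad_within_continuous.
  exact: measurable_funX mrad.
- have mtraj := mwithin _ traj_within_continuous.
  have m1 : measurable_fun setT (\1_`]0, z] : R -> R) by exact: measurable_indic.
  exact: measurableT_comp m1 mtraj.
(* [F] is known to be measurable on the positive half-line only; the radii occurring in [A] stay
   there because [rmin] is positive. *)
- have mF : measurable_fun (`]0, +oo[ : set R) F.
    have mF := measurable_int _ F_integrable.
    by move: mF => /measurable_EFinP.
  have m2 : measurable_fun A (@snd R R) by apply: measurable_funTS; exact: measurable_snd.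
  apply: measurable_comp mF m2 => // _ [p [_ _ ap _] <-]/=.
  by rewrite in_itv/= andbT (lt_le_trans rmin_gt0 ap).
Qed.

(** Tonelli with time as the outer variable. Both restricted integrals become integrals over the
    line, and the integrands are then compared pointwise, inside and outside the open quadrant. *)
Lemma mean_functionE rho z :
  mean_function rho F rad traj z =
  ((4 / 3 * pi * rho)%:E * \int[@lebesgue_measure R \x @lebesgue_measure R]_p (mass_density z p)%:E)%E.
Proof.
rewrite fubini_tonelli1; last 2 first.
  exact: mass_density_measurable.
  by move=> p; rewrite lee_fin mass_density_ge0.
rewrite /mean_function; congr (_ * _)%E; rewrite [LHS]integral_mkcond.
refine (eq_integral _ _ _) => s _.
rewrite patchE; case: ifPn => s0; last first.
  rewrite /fubini_F integral0_eq// => r _; congr EFin.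
  apply: mass_density_eq0 => /=; move: s0; apply: contra => /andP[_ s0].
  by rewrite inE/= in_itv/= s0.
rewrite /fubini_F [LHS]integral_mkcond; refine (eq_integral _ _ _) => r _.
rewrite patchE; case: ifPn => r0; last first.
  rewrite mass_density_eq0//=; move: r0; apply: contra => /andP[r0 _].
  by rewrite inE/= in_itv/= r0.
by congr EFin; rewrite -mass_densityE//=;
  move: s0 r0; rewrite !inE/= !in_itv/= !andbT.
Qed.

Lemma lifetime_region_neq0 : A !=set0.
Proof. by exists (0, rmin); split => //=; rewrite ?duration_ge0// ltW. Qed.

(** By compactness the radii on [A] are at most some C and the times at most some T. The density is
    thus dominated by C^3 |F(r)| on times in [0, T], and its integral by T times C^3 times the
    integral of |F|. *)
Lemma mass_density_integral_lty z :
  (\int[@lebesgue_measure R \x @lebesgue_measure R]_p (mass_density z p)%:E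
    < +oo)%E.
Proof.
have cfst : {within A, continuous (@fst R R)}.
  by apply: continuous_subspaceT => p; exact: cvg_fst.
have [c /set_mem Ac cmax] := compact_EVT_max lifetime_region_neq0
  lifetime_region_compact rad_within_continuous.
have [c' /set_mem Ac' c'max] := compact_EVT_max lifetime_region_neq0
  lifetime_region_compact cfst.
set C := rad c.1 c.2 in cmax; set T := c'.1 in c'max.
pose g (r : R) : \bar R := ((C ^+ 3)%:E * (F r)%:E)%E.
have ig : lebesgue_measure.-integrable (`]0, +oo[ : set R) g.
  exact: integrableZl.
pose K := (\int[@lebesgue_measure R]_(r in `]0%R, +oo[) `|g r|)%E.
have Koo : (K < +oo)%E by have /integrableP[] := ig.
have K0 : (0 <= K)%E by exact: integral_ge0.
have mgabs : measurable_fun (`]0, +oo[ : set R) (fun r => `|g r|)%E.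
  by apply: measurableT_comp => //; exact: (measurable_int _ ig).
have mm := mass_density_measurable z.
have m0 p : (0 <= (EFin \o mass_density z) p)%E by rewrite lee_fin mass_density_ge0.
rewrite fubini_tonelli1//.
(* At fixed time s the inner integral is at most [K], and it is zero when s lies outside [0, T]. *)
apply: (@le_lt_trans _ _ (\int[@lebesgue_measure R]_s (K * (\1_`[0%R, T] s)%:E))%E).
  apply: ge0_le_integral => //.
  - by move=> s _; apply: integral_ge0 => r _; exact: m0.
  - exact: measurable_fun_fubini_tonelli_F.
  - apply: emeasurable_funM => //; apply/measurable_EFinP.
    exact: measurable_indic.
  move=> s _; rewrite indicE; have [sT|sT] := boolP (s \in `[0, T]%classic).
    rewrite mule1 /K integral_mkcond; apply: ge0_le_integral => //.
    - by move=> r _; exact: m0.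
    - exact: (measurable_fun_pair2 s mm).
    - exact/(measurable_restrictT _ _).1.
    move=> r _; rewrite patchE /mass_density/= patchE.
    case: ifPn => [/set_mem Asr|_]; last first.
      by case: ifPn => _; [rewrite lee_fin normr_ge0|exact: lexx].
    have [/= s0 _ ar rb] := Asr; have r0 : 0 < r by exact: lt_le_trans ar.
    rewrite mem_set/= ?in_itv/= ?r0// lee_fin.
    have Fr : 0 < F r by rewrite F_gt0// ar.
    have radC : rad s r <= C by exact: (cmax (s, r) (mem_set Asr)).
    have rad0 : 0 <= rad s r by exact: (rad_ge0 family).
    apply: le_trans (ler_norm _).
    rewrite ler_wpM2r//; first exact: ltW.
    apply: (@le_trans _ _ (rad s r ^+ 3)).
      by rewrite ler_piMr ?exprn_ge0// indicE lern1 leq_b1.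
    by rewrite lerXn2r// nnegrE// (le_trans rad0).
  rewrite mule0 le_eqVlt; apply/orP; left; apply/eqP/integral0_eq => r _.
  congr EFin; rewrite /mass_density patchE; case: ifPn => // /set_mem Asr.
  have [/= s0 _ _ _] := Asr; move: sT; rewrite notin_setE/= in_itv/= s0/=.
  by rewrite (c'max (s, r) (mem_set Asr)).
rewrite ge0_integralZl//; last first.
  by apply/measurable_EFinP; exact: measurable_indic.
rewrite integral_indic// setIT lte_mul_pinfty//.
  by rewrite ge0_fin_numE.
rewrite [X in (X < _)%E](lebesgue_measure_itv `[0, T])/=.
by case: ifP => // _; rewrite -EFinB ltry.
Qed.

(** * Growth of the integral up to the greatest height *)

Lemma mass_density_le z M q : z <= M -> mass_density z q <= mass_density M q.
Proof.
move=> zM; rewrite /mass_density !patchE; case: ifPn => // /set_mem[q0 _ aq qb].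
have q2 : 0 < q.2 by exact: lt_le_trans aq.
have Fq : 0 < F q.2 by rewrite F_gt0// aq.
have rad0 : 0 <= rad q.1 q.2 by exact: (rad_ge0 family).
rewrite ler_pM2r// ler_wpM2l ?exprn_ge0// !indicE ler_nat.
case: (boolP (_ \in `]0, z]%classic)) => // /set_mem/=.
by rewrite in_itv/= => /andP[t0 tz]; rewrite mem_set//= in_itv/= t0 (le_trans tz).
Qed.

(** A positive height rules out time 0 and, by absorption, a zero radius. Hence all factors of the
    density at [M] are positive, whereas the indicator for [z] is zero. *)
Lemma mass_density_lt z M q : A q -> 0 <= z -> z < traj q.1 q.2 ->
  traj q.1 q.2 <= M -> mass_density z q < mass_density M q.
Proof.
move=> Aq z0 zq qM; have [q0 _ aq qb] := Aq.
have q2 : 0 < q.2 by exact: lt_le_trans aq.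
have traj0 : 0 < traj q.1 q.2 by exact: le_lt_trans zq.
have q1 : 0 < q.1.
  rewrite lt0r q0 andbT; apply: contraTneq traj0 => ->.
  by rewrite (traj_init family)// ltxx.
have rad0 : 0 < rad q.1 q.2.
  rewrite lt0r (rad_ge0 family)// andbT; apply: contraTneq traj0 => radq0.
  by have [_ ->] := rad_absorbed family q2 q1 radq0 (lexx _); rewrite ltxx.
rewrite /mass_density !patchE mem_set// !indicE.
rewrite memNset ?mulr0 ?mul0r /=; last by rewrite in_itv/= leNgt zq andbF.
rewrite mem_set/= ?in_itv/= ?traj0// mulr1 mulr_gt0 ?exprn_gt0//.
by rewrite F_gt0// aq.
Qed.

(** The point [p] may lie on the boundary of [A], at the end of a trajectory or at an extreme
    radius, so no neighbourhood of it need be inside [A]. A rectangle near it, but strictly earlier,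
    has positive measure and does lie in [A]. *)
Lemma mass_density_integral_lt M z p :
  (forall q, A q -> traj q.1 q.2 <= M) -> 0 <= z -> A p -> z < traj p.1 p.2 ->
  (\int[@lebesgue_measure R \x @lebesgue_measure R]_q (mass_density z q)%:E <
   \int[@lebesgue_measure R \x @lebesgue_measure R]_q (mass_density M q)%:E)%E.
Proof.
move: p => [t0 r0] /= trajM z0 Ap zp.
have [/= t0_ge0 t0D ar0 r0b] := Ap.
have rmin_r0 : 0 < r0 by exact: lt_le_trans ar0.
have t0_gt0 : 0 < t0.
  rewrite lt0r t0_ge0 andbT; apply: contraTneq zp => ->.
  by rewrite (traj_init family)// -leNgt.
have [e e0 trajz] : exists2 e : R, 0 < e & forall q, A q -> ball t0 e q.1 ->
    ball r0 e q.2 -> z < traj q.1 q.2.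
  have /subspace_continuousP/(_ _ Ap)/= := traj_within_continuous.
  move=> /(_ _ (lt_nbhsr zp))/= /nbhs_ballP[e/= e0 eP]; exists e => // q Aq q1 q2.
  exact: (eP q).
(* The times used lie in ]s1, s2[, within [e] of [t0]. Ending at the midpoint [s2] leaves the gap s2
   < t0 <= D(r0), with D the duration, so that by continuity the duration still exceeds [s2] at
   nearby radii. *)
set s1 := Order.max 0 (t0 - e).
set s2 := (s1 + t0) / 2.
have s1t0 : s1 < t0 by rewrite /s1 gt_max t0_gt0 ltrBlDr ltrDl.
have s1s2 : s1 < s2 by rewrite midf_lt.
have s2t0 : s2 < t0 by rewrite midf_lt.
have r0ab : `[rmin, rmax]%classic r0 by rewrite /= in_itv/= ar0.
have [d d0 dD] : exists2 d : R, 0 < d & forall r, rmin <= r <= rmax ->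
    ball r0 d r -> s2 < fine (duration rad traj r).
  have /subspace_continuousP/(_ _ r0ab) := duration_continuous.
  have sD : s2 < fine (duration rad traj r0).
    by rewrite (lt_le_trans s2t0)// -lee_fin fineK// duration_finite.
  move=> /(_ _ (lt_nbhsr sD))/= /nbhs_ballP[d/= d0 dP]; exists d => // r rab rd.
  by apply: (dP r).
(* Trimming to [rmin, rmax] keeps a nonempty open interval even when [r0] is an endpoint, since rmin
   < rmax. *)
set r1 := Order.max rmin (r0 - Order.min d e).
set r2 := Order.min rmax (r0 + Order.min d e).
have de0 : 0 < Order.min d e by rewrite lt_min d0.
have r1r2 : r1 < r2.
  rewrite lt_min !gt_max rmin_lt_rmax; lra.
have ER : `]s1, s2[ `*` `]r1, r2[ `<=` [set q | A q /\ z < traj q.1 q.2].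
  move=> [s r] []/=; rewrite !in_itv/= => /andP[s1s ss2] /andP[r1r rr2].
  move: s1s r1r rr2; rewrite /s1 /r1 /r2 !gt_max !lt_min.
  move=> /andP[s0 ts] /andP[ar r0r] /andP[rb rr0].
  have rab : rmin <= r <= rmax by rewrite !ltW.
  have rde : `|r0 - r| < Order.min d e.
    by rewrite ltr_norml; apply/andP; split; lra.
  move: rde; rewrite lt_min => /andP[rd re].
  have Asr : A (s, r).
    case/andP: (rab) => ar' rb'; split => //=; first exact: ltW.
    rewrite -[duration _ _ _]fineK ?duration_finite// lee_fin.
    by rewrite (le_trans (ltW ss2))// ltW// dD.
  split => //; apply: (trajz (s, r)) => //=.
  by rewrite /ball/= ltr_norml; apply/andP; split; lra.
apply: (@lt_integral _ _ _ (@lebesgue_measure R \x @lebesgue_measure R)%E setT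
  (`]s1, s2[ `*` `]r1, r2[) (EFin \o mass_density z) (EFin \o mass_density M)) => //.
- exact: mass_density_measurable.
- exact: mass_density_measurable.
- by move=> q _; rewrite lee_fin mass_density_ge0.
- by move=> q _; rewrite lee_fin mass_density_le// (le_trans (ltW zp))// (trajM (t0, r0)).
- exact: mass_density_integral_lty.
- by apply: measurableX.
- rewrite [X in (_ < X)%E]product_measure1E//.
  have itv_gt0 (x y : R) : x < y -> (0 < @lebesgue_measure R `]x, y[)%E.
    by move=> xy; rewrite lebesgue_measure_itv/= lte_fin xy -EFinB lte_fin subr_gt0.
  by rewrite mule_gt0 ?itv_gt0.
- by move=> q /ER[Aq zq]; rewrite lte_fin mass_density_lt// trajM.
Qed.

Lemma mass_density_const M z : (forall q, A q -> traj q.1 q.2 <= M) ->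
  M <= z -> mass_density z = mass_density M.
Proof.
move=> trajM Mz; apply/funext => q; rewrite /mass_density !patchE.
case: ifPn => // /set_mem Aq; congr (_ * _ * _); rewrite !indicE.
congr (nat_of_bool _)%:R; apply/idP/idP; rewrite !inE/= !in_itv/= trajM// => /andP[-> _] //.
by rewrite (le_trans (trajM _ Aq)).
Qed.

(** * Identification of the top quantile *)

Lemma max_traj_top_quantile rho M : 0 < rho ->
  is_maximum [set traj p.1 p.2 | p in A] M ->
  is_top_quantile (mean_function rho F rad traj) M.
Proof.
move=> rho0 [[p Ap pM] ubM].
have trajM q : A q -> traj q.1 q.2 <= M by move=> Aq; apply: ubM; exists q.
split.
- have [p1 _ ap _] := Ap; rewrite -pM (traj_ge0 family)//.
  exact: lt_le_trans ap.
- by move=> z Mz; rewrite !mean_functionE (mass_density_const trajM Mz).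
- move=> z z0 zM; rewrite !mean_functionE lte_pmul2l//; last first.
    by rewrite lte_fin !mulr_gt0 ?pi_gt0// invr_gt0.
  by apply: (mass_density_integral_lt trajM z0 Ap); rewrite pM.
Qed.

Lemma exists_max_traj : exists M, is_maximum [set traj p.1 p.2 | p in A] M.
Proof.
have [c /set_mem Ac cmax] := compact_EVT_max lifetime_region_neq0
  lifetime_region_compact traj_within_continuous.
exists (traj c.1 c.2); split; first by exists c.
by move=> _ [q Aq <-]; exact/cmax/mem_set.
Qed.

End mass_density.

(** For two distinct candidates, constancy beyond the smaller contradicts strict increase before the
    larger. *)
Lemma is_top_quantile_unique (R : realType) (m : R -> \bar R) (q q' : R) :
  is_top_quantile m q -> is_top_quantile m q' -> q = q'.
Proof.
move=> [q0 qcst qlt] [q'0 q'cst q'lt]; have [qq'|q'q|//] := ltgtP q q'.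
- by have := q'lt _ q0 qq'; rewrite (qcst _ (ltW qq')) ltxx.
- by have := qlt _ q'0 q'q; rewrite (q'cst _ (ltW q'q)) ltxx.
Qed.

Theorem corollary3p5 (R : realType) (rho rmin rmax : R) (F : R -> R)
    (rad traj : R -> R -> R)
    (rho_gt0 : 0 < rho)
    (rmin_gt0 : 0 < rmin)
    (rmin_lt_rmax : rmin < rmax)
    (F_integrable :
      lebesgue_measure.-integrable (`]0, +oo[ : set R) (EFin \o F))
    (F_gt0 : forall r, rmin <= r <= rmax -> 0 < F r)
    (F_eq0 : forall r, 0 < r -> ~~ (rmin <= r <= rmax) -> F r = 0)
    (family : trajectory_family rad traj)
    (duration_finite :
      forall r, rmin <= r <= rmax -> duration rad traj r \is a fin_num)
    (duration_continuous :
      {within `[rmin, rmax], continuous (fun r => fine (duration rad traj r))})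
    (joint_continuous :
      {within lifetime_region rmin rmax rad traj,
        continuous (fun p : R * R => (rad p.1 p.2, traj p.1 p.2))})
    (mean_continuous :
      {within `[0, +oo[, continuous (mean_function rho F rad traj)}) :
  exists2 M : R,
    is_maximum
      [set traj p.1 p.2 | p in lifetime_region rmin rmax rad traj] M
    & forall z100 : R,
        is_top_quantile (mean_function rho F rad traj) z100 <-> z100 = M.
Proof.
have [M maxM] := exists_max_traj rmin_lt_rmax duration_finite
  duration_continuous joint_continuous.
have topM : is_top_quantile (mean_function rho F rad traj) M.
  exact: (max_traj_top_quantile (rmin := rmin) (rmax := rmax)).
by exists M => // z100; split => [/is_top_quantile_unique/(_ topM)|->].
Qed.
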